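(* Let $k$ be a field of characteristic zero. The conjugacy classes of $\mathrm{BAs}_3(k)$ in $\mathrm{BAs}_3(k)$ are those of (1) $(x_1,x_2,x_3+\lambda)$, $\lambda\in k$; (2) $(x_1+f_1(x_2,x_3),\,x_2+f_2(x_3),\,x_3)$, where $f_2(x_3)=c_mx_3^m+c_{m-2}x_3^{m-2}+\cdots+c_0\in k[x_3]$ with $c_m\neq 0$ (the next-to-highest coefficient is zero), and $$f_1(x_2,x_3)=a_n(x_3)x_2^n+a_{n-1}(x_3)x_2^{n-1}+\cdots+a_0(x_3),$$ where for $i=0,1,\ldots,n-2,n$ the polynomial $a_i(x_3)$ is the lowest degree element in $a_i(x_3)+f_2(x_3)k[x_3]$, while $a_{n-1}(x_3)$ is the lowest degree element in $a_{n-1}(x_3)+(f_2(x_3),a_n(x_3))k[x_3]$.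
   Context: $\mathrm{BAs}_3(k)$ is the group (under composition) of strictly triangular polynomial maps $(x_1+f_1,x_2+f_2,x_3+f_3)$ with $f_1\in k[x_2,x_3]$, $f_2\in k[x_3]$, $f_3\in k$. Two elements $F,G$ are conjugate in $\mathrm{BAs}_3(k)$ if $G=HFH^{-1}$ for some $H\in\mathrm{BAs}_3(k)$. The lowest degree element of a coset of an ideal of $k[x_3]$ is $0$ if the coset is the ideal itself.
   Formalization: In (2) the case f_2 = 0 is also allowed, although the text requires c_m ≠ 0; without it the claim fails, e.g. (x_1+x_2, x_2, x_3) is conjugate to no map in (1) and to none in (2) with f_2 ≠ 0. *)

(* Defs.v *)
From HB Require Import structures.
From mathcomp Require Import all_boot all_order all_algebra.
From mathcomp Require Import mpoly.

Set Implicit Arguments.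
Unset Strict Implicit.
Unset Printing Implicit Defensive.

Import GRing.Theory.
Local Open Scope ring_scope.

Section BAs3.
Variable k : fieldType.

(* A polynomial map of affine 3-space is the triple of its components; the
   coordinates x_1, x_2, x_3 are the variables of index 0, 1, 2. *)
Definition polymap := (3.-tuple {mpoly k[3]})%type.

Definition x1 : {mpoly k[3]} := 'X_(@Ordinal 3 0 isT).
Definition x2 : {mpoly k[3]} := 'X_(@Ordinal 3 1 isT).
Definition x3 : {mpoly k[3]} := 'X_(@Ordinal 3 2 isT).

Definition idmap : polymap := [tuple x1; x2; x3].

(* F o G : the components of G are substituted into those of F. *)
Definition compmap (F G : polymap) : polymap :=
  [tuple tnth F i \mPo G | i < 3].

(* An element of k[x_2, x_3] is given as f : {poly {poly k}}, a polynomial in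
   x_2 with coefficients f`_i in k[x_3]. *)
Definition in_x3 (f : {poly k}) : {mpoly k[3]} := horner_alg x3 f.
Definition in_x2x3 (f : {poly {poly k}}) : {mpoly k[3]} :=
  (map_poly in_x3 f).[x2].

Definition trimap (f1 : {poly {poly k}}) (f2 : {poly k}) (f3 : k) : polymap :=
  [tuple x1 + in_x2x3 f1; x2 + in_x3 f2; x3 + f3%:MP].

Definition BAs3 (F : polymap) : Prop := exists f1 f2 f3, F = trimap f1 f2 f3.

(* H' is the inverse H^{-1} of H in the group BAs_3(k). *)
Definition BAs3_conj (F G : polymap) : Prop :=
  exists H H' : polymap,
    [/\ BAs3 H, BAs3 H', compmap H H' = idmap, compmap H' H = idmap
      & G = compmap (compmap H F) H'].

Definition BAs3_class (F : polymap) (C : polymap -> Prop) : Prop :=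
  forall G, C G <-> BAs3_conj F G.

Definition is_BAs3_class (C : polymap -> Prop) : Prop :=
  exists2 F, BAs3 F & BAs3_class F C.

Definition ideal1 (f : {poly k}) : {poly k} -> Prop :=
  fun q => exists u, q = u * f.
Definition ideal2 (f g : {poly k}) : {poly k} -> Prop :=
  fun q => exists u v, q = u * f + v * g.

(* Degrees are compared through size, so 0 lies strictly below the nonzero
   constants; hence the lowest degree element of the coset I is 0. *)
Definition lowest_in_coset (I : {poly k} -> Prop) (p a : {poly k}) : Prop :=
  I (a - p) /\ forall q, I (q - p) -> (size a <= size q)%N.

(* For f <> 0 of degree m = (size f).-1 this says c_{m-1} = 0; it is vacuous
   for constants, including 0. *)
Definition no_next_to_highest (f : {poly k}) : Prop :=
  forall j, j.+2 = size f -> f`_j = 0.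

Definition normal_form1 (F : polymap) : Prop :=
  exists lambda : k, F = trimap 0 0 lambda.

(* For f1 <> 0, n = (size f1).-1 is its degree in x_2, so that
   a_n = lead_coef f1 <> 0; all conditions are vacuous for f1 = 0.  The case
   f2 = 0 is allowed: the maps (x_1 + f1, x_2, x_3) with f1 <> 0 are conjugate
   neither to a translation of x_3 nor to a map with f2 <> 0. *)
Definition normal_form2 (F : polymap) : Prop :=
  exists (f1 : {poly {poly k}}) (f2 : {poly k}),
    [/\ F = trimap f1 f2 0,
        no_next_to_highest f2,
        forall i, (i < size f1)%N -> i.+2 <> size f1 ->
          lowest_in_coset (ideal1 f2) f1`_i f1`_i
      & forall i, i.+2 = size f1 ->
          lowest_in_coset (ideal2 f2 (lead_coef f1)) f1`_i f1`_i].

End BAs3.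

(* Main.v *)
(* Conjugation is reached through intertwiners: if G o H = H o F then
   G = H F H^-1.  If F moves x_3 by a <> 0, then since q(x + a) - q(x) takes
   every polynomial value in characteristic 0, an intertwiner kills the second
   and then the first component.  If F fixes x_3, translating x_3 removes the
   next-to-highest coefficient of f_2.  With f_2 fixed, conjugating by
   x_1 + v x_2^(i+1) adds (i+1) v f_2 to the coefficient a_i and changes only
   lower ones, while conjugating by x_2 + v leaves f_2 alone and adds a multiple
   n v a_n to a_(n-1).  So the coefficients can be reduced from the top down,
   starting over with a smaller n whenever a_n is reduced to 0. *)
Require Import Defs.
From mathcomp Require Import all_boot all_order all_algebra.
From mathcomp Require Import mpoly.
Import GRing.Theory.
Local Open Scope ring_scope.

Set Implicit Arguments.
Unset Strict Implicit.
Unset Printing Implicit Defensive.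

(** * Top coefficients of translated polynomials *)

Lemma coef_XaddC_exp (R : comNzRingType) (c : R) (i j : nat) :
  (('X + c%:P) ^+ i)`_j = c ^+ (i - j) *+ 'C(i, j).
Proof.
rewrite addrC exprDn coef_sum; have [lt_ij|le_ji] := ltnP i j.
  rewrite bin_small // mulr0n big1 // => l _.
  rewrite -rmorphXn coefMn coefCM coefXn gtn_eqF ?mulr0 ?mul0rn //.
  by rewrite (leq_trans (ltn_ord l)).
rewrite (bigD1 (inord j)) //= inordK // big1 ?addr0 => [|l ne_lj].
  by rewrite -rmorphXn coefMn coefCM coefXn eqxx mulr1.
rewrite -rmorphXn coefMn coefCM coefXn.
suff /negPf-> : j != l by rewrite mulr0 mul0rn.
by apply: contraNneq ne_lj => ->; rewrite inord_val.
Qed.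

(** The coefficient of X^j in (X + c)^i is binomial(i, j) c^(i - j). In degree at most n + 1, with j
    >= n, only i = j and the pair (n + 1, n) contribute. *)
Lemma coef_comp_XaddC (R : comNzRingType) (p : {poly R}) (c : R) (n j : nat) :
    (size p <= n.+2)%N -> (n <= j)%N ->
  (p \Po ('X + c%:P))`_j = p`_j + ((p`_n.+1 * c) *+ n.+1) *+ (j == n).
Proof.
move=> sp le_nj; rewrite /comp_poly (@horner_coef_wide _ n.+2); last first.
  exact: leq_trans (size_poly _ _) sp.
have coefE i : ((map_poly polyC p)`_i * ('X + c%:P) ^+ i)`_j
    = p`_i * (c ^+ (i - j) *+ 'C(i, j)).
  by rewrite coef_map coefCM coef_XaddC_exp.
rewrite coef_sum !big_ord_recr /= big1 => [|i _]; last first.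
  by rewrite coefE bin_small ?mulr0n ?mulr0 // (leq_trans (ltn_ord i)).
rewrite !coefE add0r; have [->|ne_jn] := eqVneq j n.
  by rewrite subnn binn subSnn binSn mulr1 expr1 mulrnAr mulr1n.
have {le_nj ne_jn} lt_nj: (n < j)%N by rewrite ltn_neqAle eq_sym ne_jn.
rewrite (@bin_small n) // mulr0n mulr0 add0r addr0.
have [<-|ne_nj] := eqVneq n.+1 j; first by rewrite subnn binn mulr1.
have {}lt_nj : (n.+1 < j)%N by rewrite ltn_neqAle ne_nj.
by rewrite bin_small // mulr0n mulr0 nth_default // (leq_trans sp).
Qed.

(** A difference drops the degree by one, with a top coefficient governed by [a]. This serves both
    to solve difference equations and to alter one coefficient of f_1 while keeping the higher
    ones. *)
Lemma coef_difference_monomial (R : comNzRingType) (a c : R) (n j : nat) :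
    (n <= j)%N ->
  (((a%:P * 'X^(n.+1)) \Po ('X + c%:P)) - a%:P * 'X^(n.+1))`_j =
    ((a * c) *+ n.+1) *+ (j == n).
Proof.
move=> le_nj; rewrite coefB (@coef_comp_XaddC _ _ _ n) //; last first.
  apply/leq_sizeP => l lt_nl.
  by rewrite coefCM coefXn gtn_eqF ?mulr0.
by rewrite addrAC subrr add0r coefCM coefXn eqxx mulr1.
Qed.

Lemma size_eq_coef (R : nzSemiRingType) (p q : {poly R}) (n : nat) :
  size p = n.+1 -> (forall j, (n <= j)%N -> q`_j = p`_j) -> size q = n.+1.
Proof.
move=> sp eq_qp; apply/eqP; rewrite eqn_leq; apply/andP; split.
  apply/leq_sizeP => j lt_nj.
  by rewrite eq_qp ?(ltnW lt_nj) // nth_default // sp.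
rewrite ltnNge; apply/negP => sq.
have : lead_coef p != 0 by rewrite lead_coef_eq0 -size_poly_eq0 sp.
by rewrite lead_coefE sp /= -eq_qp // nth_default ?eqxx.
Qed.

(** * Lowest degree elements of cosets as remainders *)

Section Lowest.
Variable k : fieldType.
Implicit Types f g p : {poly k}.

(** All elements of a coset have the same remainder, which is never longer than the dividend. For f
    = 0 the coset is a single point and [p %% 0] is [p]. *)
Lemma lowest_ideal1_modp f p : lowest_in_coset (ideal1 f) (p %% f) (p %% f).
Proof.
split=> [|q [u defq]]; first by exists 0; rewrite subrr mul0r.
have -> : p %% f = q %% f; last exact: leq_modp.
rewrite -[q](subrK (p %% f)) defq modpD modp_mull add0r.
by rewrite modp_id.
Qed.

(** By Bezout the ideal is principal, so the condition on a_(n-1) also becomes a division with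
    remainder. *)
Lemma ideal2P f g p : ideal2 f g p <-> gcdp f g %| p.
Proof.
split=> [[u [v ->]]|].
  by rewrite dvdp_add // dvdp_mull ?dvdp_gcdl ?dvdp_gcdr.
have [[u v] /= /eqp_dvdl<-] := Bezoutp f g.
case/dvdpP=> w ->; exists (w * u), (w * v).
by rewrite mulrDr !mulrA.
Qed.

Lemma lowest_ideal2_modp f g p :
  lowest_in_coset (ideal2 f g) (p %% gcdp f g) (p %% gcdp f g).
Proof.
have [_ lowest] := lowest_ideal1_modp (gcdp f g) p.
split=> [|q /ideal2P/dvdpP]; last exact: lowest.
by apply/ideal2P; rewrite subrr dvdp0.
Qed.

End Lowest.

Lemma comp_polyXsubC_K (R : comNzRingType) (p : {poly R}) (c : R) :
  (p \Po ('X - c%:P)) \Po ('X + c%:P) = p.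
Proof. by have := comp_polyXaddC_K p (- c); rewrite polyCN opprK. Qed.

(** * Difference equations in characteristic zero *)

Section Difference.
Variables (k : fieldType) (char0 : [pchar k] =i pred0).

Lemma natf_neq0_char0 n : n.+1%:R != 0 :> k.
Proof. by rewrite (pcharf0P k).1. Qed.

Lemma mulrSn_surj n (p : {poly k}) : exists q, q *+ n.+1 = p.
Proof.
exists (n.+1%:R^-1 *: p); rewrite -scaler_nat scalerA mulfV ?scale1r //.
exact: natf_neq0_char0.
Qed.

Lemma difference_surj (c : k) (p : {poly k}) :
  c != 0 -> exists q, q \Po ('X + c%:P) - q = p.
Proof.
move=> c_neq0; have [n] := ubnP (size p); elim: n p => // n IHn p.
rewrite ltnS => sp; case: n => [|n] in IHn sp *.
  move: sp; rewrite leqn0 size_poly_eq0 => /eqP->.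
  by exists 0; rewrite comp_poly0 subrr.
(* Chosen so that the difference of a X^(n+1) has leading term p_n X^n; subtracting it shortens
   p. *)
set a := p`_n / (c *+ n.+1).
pose d := a%:P * 'X^(n.+1) : {poly k}.
have [|q def_q] := IHn (p - (d \Po ('X + c%:P) - d)).
  rewrite ltnS; apply/leq_sizeP => j le_nj.
  rewrite coefB coef_difference_monomial // -mulrnAr /a divfK; last first.
    by rewrite -mulr_natr mulf_neq0 // natf_neq0_char0.
  have [->|ne_jn] := eqVneq j n; first by rewrite mulr1n subrr.
  by rewrite subr0 nth_default // (leq_trans sp) // ltn_neqAle eq_sym ne_jn.
by exists (q + d); rewrite comp_polyD opprD addrACA def_q subrK.
Qed.

End Difference.

(** * The group of triangular maps and its conjugacy relation *)

Section Group.
Variable k : fieldType.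
Implicit Types (F G H : polymap k) (f g h p : {poly k}) (a b c : k).
Implicit Types r s t : {poly {poly k}}.

Lemma in_x3D : {morph @in_x3 k : f g / f + g}.
Proof. by move=> f g; rewrite /in_x3 rmorphD. Qed.

Lemma in_x2x3D : {morph @in_x2x3 k : r s / r + s}.
Proof. by move=> r s; rewrite /in_x2x3 rmorphD hornerD. Qed.

(* The substitution of (x_2 + g, x_3 + c) for (x_2, x_3). *)
Definition shift23 g c r : {poly {poly k}} :=
  map_poly (comp_poly ('X + c%:P)) r \Po ('X + g%:P).

Lemma shift23_0r g r : shift23 g 0 r = r \Po ('X + g%:P).
Proof.
congr (_ \Po _); apply: map_poly_id => f _.
by rewrite addr0 comp_polyXr.
Qed.

Lemma shift23_0l c r : shift23 0 c r = map_poly (comp_poly ('X + c%:P)) r.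
Proof. by rewrite /shift23 addr0 comp_polyXr. Qed.

Lemma tnth_trimap r f a (i : 'I_3) :
  tnth (trimap r f a) i =
    nth 0 [:: x1 k + in_x2x3 r; x2 k + in_x3 f; x3 k + a%:MP] i.
Proof. exact: tnth_nth. Qed.

Lemma comp_in_x3 f G c : tnth G (@Ordinal 3 2 isT) = x3 k + c%:MP ->
  in_x3 f \mPo G = in_x3 (f \Po ('X + c%:P)).
Proof.
move=> defG3; rewrite /in_x3 /horner_alg /horner_morph /= -horner_map.
rewrite -map_poly_comp map_comp_poly horner_comp rmorphD /= map_polyX map_polyC.
rewrite hornerD hornerX hornerC comp_mpolyXU -tnth_nth defG3 /= alg_mpolyC.
by congr _.[_]; apply: eq_map_poly => a /=; rewrite !alg_mpolyC comp_mpolyC.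
Qed.

Lemma comp_in_x2x3 r s f c :
  in_x2x3 r \mPo trimap s f c = in_x2x3 (shift23 f c r).
Proof.
rewrite /in_x2x3 -[@in_x3 k]/(horner_alg (x3 k)) -horner_map -map_poly_comp.
rewrite /shift23 map_comp_poly horner_comp.
rewrite rmorphD /= map_polyX map_polyC hornerD hornerX hornerC comp_mpolyXU.
rewrite -map_poly_comp; congr _.[_].
by apply: eq_map_poly => g /=; apply: comp_in_x3; rewrite tnth_trimap.
Qed.

(** Thanks to this formula, conjugations are later checked on the parameters, in k[x_3][x_2], rather
    than in k[x_1, x_2, x_3]. *)
Lemma compmap_trimap r f a s g c :
  compmap (trimap r f a) (trimap s g c) =
    trimap (s + shift23 g c r) (g + (f \Po ('X + c%:P))) (c + a).
Proof.
apply: eq_from_tnth => i; rewrite tnth_mktuple !tnth_trimap.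
case: i => [[|[|[|//]]] lti] /=; rewrite comp_mpolyD comp_mpolyXU /= -addrA.
- by rewrite comp_in_x2x3 in_x2x3D.
- by rewrite (@comp_in_x3 _ _ c) ?tnth_trimap // in_x3D.
- by rewrite comp_mpolyC mpolyCD.
Qed.

Lemma idmap_trimap : idmap k = trimap 0 0 0.
Proof.
by rewrite /trimap /in_x2x3 /in_x3 map_poly0 horner0 raddf0 mpolyC0 !addr0.
Qed.

Lemma compmapA F G H : compmap (compmap F G) H = compmap F (compmap G H).
Proof.
apply: eq_from_tnth => i; rewrite !tnth_mktuple.
rewrite [tnth F i \mPo G]comp_mpolyEX [RHS]comp_mpolyEX raddf_sum.
apply: eq_bigr => m _.
rewrite [LHS]comp_mpolyZ !comp_mpolyX rmorph_prod /=; congr (_ *: _).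
by apply: eq_bigr => j _; rewrite rmorphXn tnth_mktuple.
Qed.

Lemma compmap1 F : compmap F (idmap k) = F.
Proof.
apply: eq_from_tnth => i; rewrite tnth_mktuple -[RHS]comp_mpoly_id.
congr (_ \mPo _); apply: eq_from_tnth => -[[|[|[|//]]] lti];
  by rewrite tnth_mktuple (tnth_nth 0) /=; congr 'X__; apply: val_inj.
Qed.

Lemma comp1map F : compmap (idmap k) F = F.
Proof.
apply: eq_from_tnth => i; rewrite tnth_mktuple (tnth_nth 0 F).
by case: i => [[|[|[|//]]] lti]; rewrite (tnth_nth 0) /= comp_mpolyXU.
Qed.

Lemma BAs3_trimap r f a : BAs3 (trimap r f a).
Proof. by exists r, f, a. Qed.

Lemma BAs3_compmap F G : BAs3 F -> BAs3 G -> BAs3 (compmap F G).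
Proof.
move=> [r [f [a ->]]] [s [g [c ->]]]; rewrite compmap_trimap.
exact: BAs3_trimap.
Qed.

(** Each parameter of a product is that of the right factor plus a term involving only the left
    factor and later coordinates of the right one, so the inverse is solved for from x_3 upwards. *)
Lemma BAs3_right_inverse F :
  BAs3 F -> exists2 G, BAs3 G & compmap F G = idmap k.
Proof.
move=> [r [f [a ->]]]; pose g := - (f \Po ('X + (- a)%:P)).
exists (trimap (- shift23 g (- a) r) g (- a)); first exact: BAs3_trimap.
by rewrite compmap_trimap !addNr idmap_trimap.
Qed.

(** A right inverse G of F has a right inverse in turn, which associativity forces to be F. *)
Lemma BAs3_inverse F : BAs3 F ->
  exists G, [/\ BAs3 G, compmap F G = idmap k & compmap G F = idmap k].
Proof.
move=> /BAs3_right_inverse[G BAsG FG1].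
have [H _ GH1] := BAs3_right_inverse BAsG.
have eqFH : F = H by rewrite -[F]compmap1 -GH1 -compmapA FG1 comp1map.
by exists G; split; rewrite // [in X in compmap _ X]eqFH.
Qed.

Lemma BAs3_conj_of_intertwining F G H :
  BAs3 H -> compmap G H = compmap H F -> BAs3_conj F G.
Proof.
move=> BAsH GH_HF; have [H' [BAsH' HH' H'H]] := BAs3_inverse BAsH.
by exists H, H'; split; rewrite // -GH_HF compmapA HH' compmap1.
Qed.

Lemma BAs3_conj_intertwining F G :
  BAs3_conj F G -> exists2 H, BAs3 H & compmap G H = compmap H F.
Proof.
move=> [H [H' [BAsH _ _ H'H ->]]]; exists H => //.
by rewrite compmapA H'H compmap1.
Qed.

Lemma BAs3_conj_refl F : BAs3_conj F F.
Proof.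
apply: (@BAs3_conj_of_intertwining _ _ (idmap k)).
  by rewrite idmap_trimap; apply: BAs3_trimap.
by rewrite compmap1 comp1map.
Qed.

Lemma BAs3_conj_sym F G : BAs3_conj F G -> BAs3_conj G F.
Proof.
move=> [H [H' [BAsH BAsH' HH' H'H ->]]].
apply: (BAs3_conj_of_intertwining BAsH').
by rewrite -!compmapA H'H comp1map.
Qed.

Lemma BAs3_conj_trans F G H :
  BAs3_conj F G -> BAs3_conj G H -> BAs3_conj F H.
Proof.
move=> /BAs3_conj_intertwining[A BAsA GA] /BAs3_conj_intertwining[B BAsB HB].
apply: (BAs3_conj_of_intertwining (BAs3_compmap BAsB BAsA)).
by rewrite -compmapA HB !compmapA GA.
Qed.

(** The hypotheses are the x_1 and x_2 components of the intertwining identity for [trimap t h b];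
    the x_3 component holds because translations commute. *)
Lemma trimap_conj t h b r f a s g :
    t + shift23 h b s = r + shift23 f a t ->
    h + (g \Po ('X + b%:P)) = f + (h \Po ('X + a%:P)) ->
  BAs3_conj (trimap r f a) (trimap s g a).
Proof.
move=> eq1 eq2; apply: (BAs3_conj_of_intertwining (BAs3_trimap t h b)).
by rewrite !compmap_trimap eq1 eq2 [b + a]addrC.
Qed.

End Group.

(** * Reduction to normal form *)

Section NormalForm.
Variables (k : fieldType) (char0 : [pchar k] =i pred0).
Implicit Types (f g h u : {poly k}) (a b c : k) (r s t : {poly {poly k}}).

(** When x_3 is fixed, adding h(x_3) to x_2 commutes with adding f(x_3), so only f_1 changes. *)
Lemma conj_translate2 h r f :
  BAs3_conj (trimap r f 0) (trimap (r \Po ('X - h%:P)) f 0).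
Proof.
apply: (@trimap_conj _ 0 h 0); last by rewrite addr0 !comp_polyXr addrC.
by rewrite add0r !shift23_0r comp_polyXsubC_K comp_poly0 addr0.
Qed.

Lemma conj_translate1 t r f :
  BAs3_conj (trimap r f 0) (trimap (r + (t \Po ('X + f%:P) - t)) f 0).
Proof.
apply: (@trimap_conj _ t 0 0); last first.
  by rewrite addr0 comp_polyXr comp_poly0 addrC.
by rewrite !shift23_0r addr0 comp_polyXr addrCA subrKC.
Qed.

(** The new f_1 can stay unspecified, since this move is made before any of its coefficients is
    reduced. *)
Lemma conj_translate3 c r f :
  exists s, BAs3_conj (trimap r f 0) (trimap s (f \Po ('X - c%:P)) 0).
Proof.
exists (shift23 0 (- c) r); apply: (@trimap_conj _ 0 0 c).
  rewrite !shift23_0l -map_poly_comp add0r /shift23 !rmorph0 addr0.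
  apply: map_poly_id => p _ /=.
  by rewrite polyCN comp_polyXsubC_K.
by rewrite comp_poly0 add0r addr0 comp_polyXsubC_K.
Qed.

Lemma conj_coef_mod i u r f :
  exists s, [/\ BAs3_conj (trimap r f 0) (trimap s f 0),
    s`_i = r`_i + u * f & forall j, (i < j)%N -> s`_j = r`_j].
Proof.
(* Dividing by i + 1 cancels the factor that the difference of x_2^(i+1) produces. *)
have [v def_v] := mulrSn_surj char0 i u.
have coefE j : (i <= j)%N -> (r + ((v%:P * 'X^(i.+1)) \Po ('X + f%:P)
    - v%:P * 'X^(i.+1)))`_j = r`_j + (u * f) *+ (j == i).
  move=> le_ij; rewrite coefD coef_difference_monomial //.
  by rewrite -mulrnAl def_v.
exists (r + ((v%:P * 'X^(i.+1)) \Po ('X + f%:P) - v%:P * 'X^(i.+1))); split.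
- exact: conj_translate1.
- by rewrite coefE // eqxx.
- by move=> j lt_ij; rewrite coefE ?(ltnW lt_ij) // gtn_eqF // addr0.
Qed.

Lemma conj_next_coef_mod n u r f : size r = n.+2 ->
  exists s, [/\ BAs3_conj (trimap r f 0) (trimap s f 0),
    s`_n = r`_n + u * lead_coef r & forall j, (n < j)%N -> s`_j = r`_j].
Proof.
move=> sr; have [v def_v] := mulrSn_surj char0 n u.
have coefE j : (n <= j)%N -> (r \Po ('X + v%:P))`_j
    = r`_j + (u * lead_coef r) *+ (j == n).
  move=> le_nj; rewrite (@coef_comp_XaddC _ _ _ n) ?sr // lead_coefE sr /=.
  by rewrite [_ * v]mulrC -[_ *+ n.+1]mulrnAl def_v.
exists (r \Po ('X + v%:P)); split.
- by rewrite -[v]opprK rmorphN; apply: conj_translate2.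
- by rewrite coefE // eqxx.
- by move=> j lt_nj; rewrite coefE ?(ltnW lt_nj) // gtn_eqF // addr0.
Qed.

Lemma conj_low_coefs n r f :
  exists s, [/\ BAs3_conj (trimap r f 0) (trimap s f 0),
    forall j, (j < n)%N -> lowest_in_coset (ideal1 f) s`_j s`_j
    & forall j, (n <= j)%N -> s`_j = r`_j].
Proof.
elim: n r => [|n IHn] r; first by exists r; split=> //; apply: BAs3_conj_refl.
(* Index n goes first: its reduction may disturb the coefficients below, which the induction
   hypothesis then treats. *)
have [s [conj_rs s_n s_gt]] := conj_coef_mod n (- (r`_n %/ f)) r f.
have [t [conj_st t_lt t_ge]] := IHn s; exists t; split.
- exact: BAs3_conj_trans conj_rs conj_st.
- move=> j; rewrite ltnS leq_eqVlt => /predU1P[->|]; last exact: t_lt.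
  rewrite t_ge // s_n mulNr [X in X + _](divp_eq _ f) addrAC subrr add0r.
  exact: lowest_ideal1_modp.
- by move=> j lt_nj; rewrite t_ge ?s_gt // ltnW.
Qed.

Lemma conj_reduce1 r f :
  exists s, [/\ BAs3_conj (trimap r f 0) (trimap s f 0),
    forall i, (i < size s)%N -> i.+2 <> size s ->
      lowest_in_coset (ideal1 f) s`_i s`_i
    & forall i, i.+2 = size s ->
      lowest_in_coset (ideal2 f (lead_coef s)) s`_i s`_i].
Proof.
have [n] := ubnP (size r); elim: n r => // n IHn r; rewrite ltnS.
rewrite leq_eqVlt => /predU1P[|]; last exact: IHn.
case: n => [|n] in IHn * => sr.
  by exists r; split=> [|i|i]; rewrite ?sr //; apply: BAs3_conj_refl.
(* The leading coefficient is reduced modulo f before anything else, as the ideal for the next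
   coefficient depends on it. *)
have [s [conj_rs s_n s_gt]] := conj_coef_mod n (- (r`_n %/ f)) r f.
have {}s_n : s`_n = r`_n %% f.
  by rewrite s_n mulNr [X in X + _](divp_eq _ f) addrAC subrr add0r.
have s_le : (size s <= n.+1)%N.
  by apply/leq_sizeP => j lt_nj; rewrite s_gt // nth_default // sr.
have [s_n0|s_n_neq0] := eqVneq s`_n 0.
  have [|t [conj_st t1 t2]] := IHn s.
    rewrite ltnS; apply/leq_sizeP => j; rewrite leq_eqVlt.
    by case/predU1P=> [<-//|lt_nj]; rewrite nth_default // (leq_trans s_le).
  by exists t; split=> //; apply: BAs3_conj_trans conj_rs conj_st.
have ss : size s = n.+1.
  apply/eqP; rewrite eqn_leq s_le ltnNge; apply: contra_neqN s_n_neq0.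
  exact: nth_default.
(* In degree 0 the leading coefficient is the only one. Otherwise the degree is now n + 1 and
   a_(n-1) of the normal form has index n. *)
case: n => [|n] in s_n {s_gt} ss {IHn sr s_le s_n_neq0} *.
  exists s; split=> // i; rewrite ss // ltnS leqn0 => /eqP-> _.
  by rewrite s_n; apply: lowest_ideal1_modp.
pose d := lead_coef s.
(* The correction needed at index n splits as u f + v d: the part v d comes from translating x_2,
   the part u f from changing x_1. Both keep the leading coefficient d but may spoil the indices
   below n, hence these are reduced last. *)
have : gcdp f d %| s`_n %% gcdp f d - s`_n.
  rewrite [X in _ - X](divp_eq _ (gcdp f d)) opprD addrCA subrr addr0.
  by rewrite dvdpNr dvdp_mulIr.
case/ideal2P=> u [v def_uv].
have [s1 [conj_s_s1 s1_n s1_gt]] := conj_next_coef_mod v f ss.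
have [s2 [conj_s1_s2 s2_n s2_gt]] := conj_coef_mod n u s1 f.
have [t [conj_s2_t t_lt t_ge]] := conj_low_coefs n s2 f.
have t_gt j : (n < j)%N -> t`_j = s`_j.
  by move=> lt_nj; rewrite t_ge ?s2_gt ?s1_gt // ltnW.
have st : size t = n.+2 by apply: size_eq_coef ss _ => j; apply: t_gt.
exists t; split.
- apply: BAs3_conj_trans conj_rs (BAs3_conj_trans conj_s_s1 _).
  exact: BAs3_conj_trans conj_s1_s2 conj_s2_t.
- move=> i; rewrite st ltnS leq_eqVlt => /predU1P[->|lt_in] ne_in.
    by rewrite t_gt // s_n; apply: lowest_ideal1_modp.
  apply: t_lt; rewrite ltn_neqAle -ltnS lt_in andbT.
  by apply/eqP => eq_in; rewrite eq_in in ne_in.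
- move=> i; rewrite st => -[->].
  have -> : lead_coef t = d by rewrite /d !lead_coefE st ss t_gt.
  have -> : t`_n = s`_n %% gcdp f d.
    rewrite t_ge // s2_n s1_n -/d -addrA [v * d + _]addrC -def_uv.
    by rewrite addrC subrK.
  exact: lowest_ideal2_modp.
Qed.

Lemma conj_no_next_to_highest r f :
  exists s g, BAs3_conj (trimap r f 0) (trimap s g 0) /\ no_next_to_highest g.
Proof.
case sf: (size f) => [|[|m]].
- by exists r, f; split=> [|j]; [apply: BAs3_conj_refl | rewrite sf].
- by exists r, f; split=> [|j]; [apply: BAs3_conj_refl | rewrite sf].
(* Tschirnhaus translation: in degree m, f(X - c) has coefficient f_m - (m + 1) c f_(m+1), which
   vanishes for this c. *)
pose c := f`_m / (lead_coef f *+ m.+1).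
have [s conj_rs] := conj_translate3 c r f.
exists s, (f \Po ('X - c%:P)); split=> // j.
rewrite size_comp_poly2 ?size_XsubC // sf => -[->].
rewrite -polyCN (@coef_comp_XaddC _ _ _ m) ?sf // eqxx mulr1n.
rewrite mulrN mulNrn -mulrnAl.
have -> : f`_m.+1 = lead_coef f by rewrite lead_coefE sf.
rewrite mulrC divfK ?subrr // -mulr_natr mulf_neq0 ?natf_neq0_char0 //.
by rewrite lead_coef_eq0 -size_poly_eq0 sf.
Qed.

Lemma conj_normal_form2 r f :
  exists2 G, normal_form2 G & BAs3_conj (trimap r f 0) G.
Proof.
have [s [g [conj_rs g_next]]] := conj_no_next_to_highest r f.
have [t [conj_st t1 t2]] := conj_reduce1 s g.
exists (trimap t g 0); first by exists t, g.
exact: BAs3_conj_trans conj_rs conj_st.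
Qed.

(** Since x_2 is not moved, the equation splits into one difference equation in k[x_3] for each
    coefficient. *)
Lemma map_difference_surj c r : c != 0 ->
  exists t, shift23 0 c t - t = r.
Proof.
move=> c_neq0; elim/poly_ind: r => [|r f [t <-]].
  by exists 0; rewrite subr0 shift23_0l map_poly0.
have [q <-] := difference_surj char0 f c_neq0.
exists (t * 'X + q%:P).
rewrite !shift23_0l rmorphD rmorphM /= map_polyX map_polyC /=.
by rewrite mulrBl rmorphB /= opprD addrACA.
Qed.

Lemma conj_normal_form1 r f a : a != 0 ->
  BAs3_conj (trimap r f a) (trimap 0 0 a).
Proof.
move=> a_neq0; have [h def_h] := difference_surj char0 (- f) a_neq0.
apply: (@BAs3_conj_trans _ _ (trimap (r \Po ('X - h%:P)) 0 a)).
  apply: (@trimap_conj _ 0 h 0).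
    rewrite add0r !shift23_0r comp_polyXsubC_K.
    by rewrite /shift23 map_poly0 comp_poly0 addr0.
  by rewrite comp_poly0 addr0 -[f]opprK -def_h opprB subrK.
(* The second component is now x_2, so killing the first one is a difference equation in x_3 with
   x_2 as a parameter. *)
have [t def_t] := map_difference_surj (- (r \Po ('X - h%:P))) a_neq0.
apply: (@trimap_conj _ t 0 0); last by rewrite !comp_poly0.
rewrite -[r \Po _]opprK -def_t opprB subrK.
by rewrite /shift23 map_poly0 comp_poly0 addr0.
Qed.

End NormalForm.

Theorem theorem2p12 (k : fieldType) (char0 : [pchar k] =i pred0)
    (C : polymap k -> Prop) :
  is_BAs3_class C <->
  exists2 N : polymap k, normal_form1 N \/ normal_form2 N & BAs3_class N C.
Proof.
split=> [[_ [r [f [a ->]]] classC]|[N nfN classC]]; last first.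
  exists N => //; case: nfN => [[a ->]|[r [f [-> _ _ _]]]]; exact: BAs3_trimap.
have [N nfN conj_N] : exists2 N : polymap k,
    normal_form1 N \/ normal_form2 N & BAs3_conj (trimap r f a) N.
  have [->|a_neq0] := eqVneq a 0.
    have [N nfN conj_N] := conj_normal_form2 char0 r f.
    by exists N; first right.
  exists (trimap 0 0 a); first by left; exists a.
  exact: conj_normal_form1.
exists N => // G; split=> [/classC conj_G|conj_G].
  exact: BAs3_conj_trans (BAs3_conj_sym conj_N) conj_G.
by apply/classC; apply: BAs3_conj_trans conj_N conj_G.
Qed.
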